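(* Let $r\ge 2$ and let $\mu_1,\dots,\mu_r$ be positive measures on the real line, all of whose moments exist, such that every multi-index $\vec n\in\mathbb{N}^r$ is normal. Let $P_{\vec n}$ be the type II multiple orthogonal polynomials for $(\mu_1,\dots,\mu_r)$ and let $a_{\vec n,j}$, $b_{\vec n,j}$ ($1\le j\le r$, $\vec n\in\mathbb{N}^r$) be the recurrence coefficients in the nearest neighbor recurrence relations $$xP_{\vec n}(x)=P_{\vec n+\vec e_k}(x)+b_{\vec n,k}P_{\vec n}(x)+\sum_{j=1}^r a_{\vec n,j}P_{\vec n-\vec e_j}(x),\qquad 1\le k\le r.$$ Let $1\le i\ne j\le r$. Then for all $\vec n\in\mathbb{N}^r$ $$b_{\vec n+\vec e_i,j}-b_{\vec n,j}=b_{\vec n+\vec e_j,i}-b_{\vec n,i},$$ $$\sum_{k=1}^r a_{\vec n+\vec e_j,k}-\sum_{k=1}^r a_{\vec n+\vec e_i,k}=\det\begin{pmatrix} b_{\vec n+\vec e_j,i} & b_{\vec n,i}\\ b_{\vec n+\vec e_i,j} & b_{\vec n,j}\end{pmatrix},$$ and, for all $\vec n\in\mathbb{N}^r$ with $n_i\ge 1$, $$\frac{a_{\vec n,i}}{a_{\vec n+\vec e_j,i}}=\frac{b_{\vec n-\vec e_i,j}-b_{\vec n-\vec e_i,i}}{b_{\vec n,j}-b_{\vec n,i}}.$$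
   Context: $\mathbb{N}=\{0,1,2,\dots\}$. For $\vec n=(n_1,\dots,n_r)\in\mathbb{N}^r$ put $|\vec n|=n_1+\cdots+n_r$; $\vec e_j$ is the $j$-th standard unit vector. The type II multiple orthogonal polynomial $P_{\vec n}$ is the monic polynomial of degree $|\vec n|$ with $\int P_{\vec n}(x)x^k\,d\mu_j(x)=0$ for $0\le k\le n_j-1$ and every $1\le j\le r$. The multi-index $\vec n$ is called normal if the $|\vec n|\times|\vec n|$ matrix of mixed moments $M_{\vec n}$ is nonsingular, where $M_{\vec n}$ consists of $r$ blocks side by side, the $j$-th block being the $|\vec n|\times n_j$ matrix with entries $\nu^{(j)}_{s+t}$, $0\le s\le|\vec n|-1$, $0\le t\le n_j-1$, and $\nu^{(j)}_k=\int x^k\,d\mu_j(x)$ (for $\vec n=\vec 0$ the empty matrix, considered nonsingular). Normality of $\vec n$ is equivalent to existence and uniqueness of $P_{\vec n}$. When all multi-indices are normal the recurrence relations in the claim are known to hold, with $a_{\vec n,j}=\int x^{n_j}P_{\vec n}\,d\mu_j\big/\int x^{n_j-1}P_{\vec n-\vec e_j}\,d\mu_j$ if $n_j\ge1$ and $a_{\vec n,j}=0$ if $n_j=0$ (in which case the term with $P_{\vec n-\vec e_j}$ is absent); the coefficients $a_{\vec n,j}$ do not depend on $k$. *)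

(* Defs.v *)
From mathcomp Require Import all_boot all_order all_algebra.
From mathcomp Require Import all_classical all_reals all_analysis.

Set Implicit Arguments.
Unset Strict Implicit.
Unset Printing Implicit Defensive.

Import Order.TTheory GRing.Theory Num.Theory.

Local Open Scope ring_scope.

Definition multi_index (r : nat) := {ffun 'I_r -> nat}.

Definition mi_size (r : nat) (n : multi_index r) : nat := (\sum_j n j)%N.

Definition mi_add (r : nat) (n : multi_index r) (j : 'I_r) : multi_index r :=
  [ffun i => (n i + (i == j))%N].

(* n - e_j; the subtraction is truncated, so this is meaningful only when
   0 < n j. *)
Definition mi_sub (r : nat) (n : multi_index r) (j : 'I_r) : multi_index r :=
  [ffun i => (n i - (i == j))%N].

Notation "n '+e_' j" := (mi_add n j) (at level 50, j at level 9, left associativity).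
Notation "n '-e_' j" := (mi_sub n j) (at level 50, j at level 9, left associativity).

Definition real_measure (R : realType) :=
  {measure set (measurableTypeR R) -> \bar R}.

Definition finite_moments (R : realType) (mu : real_measure R) : Prop :=
  forall k : nat, mu.-integrable setT (fun x : measurableTypeR R => (x ^+ k)%:E).

Definition moment (R : realType) (mu : real_measure R) (k : nat) : R :=
  \int[mu]_x (x ^+ k).

Definition moment_matrix (R : realType) (r : nat) (mu : 'I_r -> real_measure R)
    (n : multi_index r) : 'M[R]_(mi_size n) :=
  \mxrow_(j < r) (\matrix_(s < mi_size n, t < n j) moment (mu j) (s + t)).

Definition normal_index (R : realType) (r : nat) (mu : 'I_r -> real_measure R)
    (n : multi_index r) : Prop :=
  \det (moment_matrix mu n) != 0.

Definition is_typeII (R : realType) (r : nat) (mu : 'I_r -> real_measure R)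
    (n : multi_index r) (p : {poly R}) : Prop :=
  [/\ p \is monic,
      size p = (mi_size n).+1 &
      forall (j : 'I_r) (k : nat), (k < n j)%N ->
        \int[mu j]_x (p.[x] * x ^+ k) = 0].

(* The coefficients are determined by this property: testing the recurrence
   against x^(n_j - 1) dmu_j isolates a n j when 0 < n j, and b n k is then read
   off from it. *)
Definition is_nn_recurrence (R : realType) (r : nat)
    (P : multi_index r -> {poly R}) (a b : multi_index r -> 'I_r -> R) : Prop :=
  (forall (n : multi_index r) (k : 'I_r),
     'X * P n = P (n +e_ k) + b n k *: P n
                + \sum_(j < r | (0 < n j)%N) a n j *: P (n -e_ j)) /\
  (forall (n : multi_index r) (j : 'I_r), n j = 0%N -> a n j = 0).

Definition mx22 (R : realType) (x00 x01 x10 x11 : R) : 'M[R]_2 :=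
  \matrix_(s < 2, t < 2)
    (if s == 0 then (if t == 0 then x00 else x01)
               else (if t == 0 then x10 else x11)).

(* Main.v *)
(** Write [L_j] for the moment functional of [mu_j] and [d n = b n j - b n i].
    Subtracting the recurrences for [k = i] and [k = j] gives
    [P (n + e_i) - P (n + e_j) = d n * P n].  The first two identities follow by
    comparing, in the recurrences and in this relation, the coefficients of
    degree [|n|] and [|n| - 1].  For the third one, normality of [n + e_i]
    makes [h n = L_i (P n * X^(n_i))] nonzero; integrating the recurrence
    against [x^(n_i - 1) dmu_i] yields [h n = a n i * h (n - e_i)], while
    integrating the difference relation against [x^(n_i) dmu_i] yields
    [h (n + e_j) = - d n * h n]. *)
From HB Require Import structures.
Require Import Defs.
From mathcomp Require Import all_boot all_order all_algebra.
From mathcomp Require Import all_classical all_reals all_analysis.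
From mathcomp Require Import ring.

Set Implicit Arguments.
Unset Strict Implicit.
Unset Printing Implicit Defensive.

Import Order.TTheory GRing.Theory Num.Theory.

Local Open Scope ring_scope.

(** * Moment functionals on polynomials *)

Definition moment_functional (R : comNzRingType) (nu : nat -> R) (p : {poly R}) : R :=
  \sum_(s < size p) p`_s * nu s.

Section MomentFunctional.
Variables (R : comNzRingType) (nu : nat -> R).

Lemma moment_functional_widen (m : nat) (p : {poly R}) : (size p <= m)%N ->
  moment_functional nu p = \sum_(s < m) p`_s * nu s.
Proof.
move=> le_pm; rewrite /moment_functional.
rewrite (big_ord_widen _ (fun s => p`_s * nu s) le_pm) big_mkcond.
apply: eq_bigr => s _; case: ifPn => //; rewrite -leqNgt => le_ps.
by rewrite nth_default ?mul0r.
Qed.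

Lemma moment_functional_is_linear :
  linear_for *%R (moment_functional nu).
Proof.
move=> c p q; set m := maxn (size p) (size q).
rewrite !(@moment_functional_widen m) ?leq_maxl ?leq_maxr //; last first.
  apply: leq_trans (size_polyD _ _) _; rewrite geq_max leq_maxr andbT.
  exact: leq_trans (size_scale_leq _ _) (leq_maxl _ _).
rewrite mulr_sumr -big_split; apply: eq_bigr => s _ /=.
by rewrite coefD coefZ mulrDl mulrA.
Qed.

HB.instance Definition _ := GRing.isLinear.Build R {poly R} R *%R
  (moment_functional nu) moment_functional_is_linear.

Lemma moment_functionalXn (k : nat) : moment_functional nu 'X^k = nu k.
Proof.
rewrite /moment_functional size_polyXn big_ord_recr /= big1 ?add0r; last first.
  by move=> s _; rewrite coefXn ltn_eqF ?mul0r.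
by rewrite coefXn eqxx mul1r.
Qed.

End MomentFunctional.

(** The single analytic step: integrability of the monomials lets the integral pass through the
    finite sum that expands [p]. From here on orthogonality is linear algebra on
    [moment_functional]. *)
Lemma Rintegral_horner_mulXn {R : realType} {mu : real_measure R}
    (hmom : finite_moments mu) (p : {poly R}) (k : nat) :
  \int[mu]_x (p.[x] * x ^+ k) = moment_functional (moment mu) (p * 'X^k).
Proof.
pose g (s : nat) (x : measurableTypeR R) : \bar R := ((p`_s)%:E * (x ^+ (s + k))%:E)%E.
have g_int s : mu.-integrable setT (g s).
  by apply: integrableZl => //; exact: hmom.
have pE (x : R) : (p.[x] * x ^+ k)%:E = (\sum_(s < size p) g s x)%E.
  rewrite horner_coef mulr_suml -sumEFin; apply: eq_bigr => s _.
  by rewrite /g -EFinM exprD mulrA.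
rewrite /Rintegral; under eq_integral do rewrite pE.
rewrite (integral_sum measurableT (f := fun s : 'I_(size p) => g s))//.
have gE s : (\int[mu]_x g s x)%E = (p`_s * moment mu (s + k))%:E.
  rewrite integralZl//.
  rewrite EFinM /moment /Rintegral fineK//.
  by apply: integrable_fin_num => //; exact: hmom.
under eq_bigr do rewrite gE.
rewrite sumEFin /=.
rewrite -[in RHS](coefK p) poly_def mulr_suml raddf_sum; apply: eq_bigr => s _ /=.
by rewrite -scalerAl -exprD linearZ /= moment_functionalXn.
Qed.

(** * Arithmetic of multi-indices *)

Lemma mi_size_add (r : nat) (n : multi_index r) (j : 'I_r) :
  mi_size (n +e_ j) = (mi_size n).+1.
Proof.
rewrite /mi_size (eq_bigr (fun i => n i + (i == j)))%N => [|i _]; last by rewrite ffunE.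
rewrite big_split /= -addn1; congr (_ + _)%N.
by rewrite (bigD1 j) //= eqxx big1 // => i /negPf->.
Qed.

Lemma mi_addC (r : nat) (n : multi_index r) (i j : 'I_r) :
  n +e_ i +e_ j = n +e_ j +e_ i.
Proof. by apply/ffunP => k; rewrite !ffunE addnAC. Qed.

Lemma mi_subK (r : nat) (n : multi_index r) (j : 'I_r) : (0 < n j)%N -> n -e_ j +e_ j = n.
Proof.
move=> nj_gt0; apply/ffunP => i; rewrite !ffunE.
by case: eqP => [->|_]; rewrite ?subnK ?subn0 ?addn0.
Qed.

Lemma mi_size_sub (r : nat) (n : multi_index r) (j : 'I_r) : (0 < n j)%N ->
  (mi_size (n -e_ j)).+1 = mi_size n.
Proof. by move=> nj_gt0; rewrite -(mi_size_add _ j) mi_subK. Qed.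

Lemma mi_subDC (r : nat) (n : multi_index r) (i j : 'I_r) : i != j ->
  n +e_ j -e_ i = n -e_ i +e_ j.
Proof.
move=> ij; apply/ffunP => k; rewrite !ffunE.
by case: (k =P i) => [->|_]; rewrite ?(negPf ij) ?addn0 ?subn0.
Qed.

Lemma det_mx22E (R : realType) (x00 x01 x10 x11 : R) :
  \det (mx22 x00 x01 x10 x11) = x00 * x11 - x01 * x10.
Proof.
rewrite (expand_det_row _ ord0) !big_ord_recl big_ord0 addr0.
by rewrite /cofactor !det_mx11 !mxE /= expr0 expr1 mul1r mulN1r mulrN.
Qed.

(** * Orthogonality, normality and the recurrence *)

Section TypeII.
Variables (R : realType) (r : nat) (mu : 'I_r -> real_measure R).

Local Notation L j := (moment_functional (moment (mu j))).

Lemma normal_index_inj {n : multi_index r} {q : {poly R}} :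
    normal_index mu n -> (size q <= mi_size n)%N ->
    (forall (j : 'I_r) (k : nat), (k < n j)%N -> L j (q * 'X^k) = 0) ->
  q = 0.
Proof.
move=> n_normal le_qn q_orth.
have MU : moment_matrix mu n \in unitmx by rewrite unitmxE unitfE.
have /(congr1 (mulmxr (invmx (moment_matrix mu n)))) :
    poly_rV q *m moment_matrix mu n = 0.
  rewrite /moment_matrix mul_mxrow -(@mxrow0 _ _ _ 1); apply/eq_mxrowP => j.
  apply/rowP => t; rewrite !mxE -[RHS](q_orth j t (ltn_ord t)).
  rewrite -{2}(poly_rV_K le_qn) /rVpoly poly_def mulr_suml raddf_sum.
  apply: eq_bigr => s _ /=; rewrite insubT// => ?; rewrite !mxE /=.
  by rewrite -scalerAl -exprD linearZ /= moment_functionalXn.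
by rewrite /= mulmxK// mul0mx => q0; rewrite -(poly_rV_K le_qn) q0 linear0.
Qed.

Variable P : multi_index r -> {poly R}.
Hypothesis hmom : forall j : 'I_r, finite_moments (mu j).
Hypothesis hP : forall n : multi_index r, is_typeII mu n (P n).

Lemma typeII_orth (n : multi_index r) (j : 'I_r) (k : nat) :
  (k < n j)%N -> L j (P n * 'X^k) = 0.
Proof.
by case: (hP n) => _ _ /(_ j k) P_orth /P_orth <-; rewrite Rintegral_horner_mulXn.
Qed.

Lemma typeII_coef_size (n : multi_index r) : (P n)`_(mi_size n) = 1.
Proof. by case: (hP n) => /monicP + Psize _; rewrite lead_coefE Psize. Qed.

Lemma typeII_coef0 (n : multi_index r) (k : nat) :
  (mi_size n < k)%N -> (P n)`_k = 0.
Proof. by case: (hP n) => _ Psize _ ?; rewrite nth_default ?Psize. Qed.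

Hypothesis hnormal : forall n : multi_index r, normal_index mu n.

(** Otherwise [P n], of degree only $|n|$, would satisfy every orthogonality condition of [n +e_ j];
    normality of that index would force the monic [P n] to vanish. *)
Lemma typeII_moment_neq0 (n : multi_index r) (j : 'I_r) : L j (P n * 'X^(n j)) != 0.
Proof.
case: (hP n) => Pmonic Psize _; apply/eqP => Pn0.
suff P0 : P n = 0 by have := monic_neq0 Pmonic; rewrite P0 eqxx.
apply: (normal_index_inj (hnormal (n +e_ j))); first by rewrite Psize mi_size_add.
move=> i k; rewrite ffunE; case: eqP => [->|_]; rewrite ?addn0; last exact: typeII_orth.
by rewrite addn1 ltnS leq_eqVlt => /predU1P[->//|]; exact: typeII_orth.
Qed.

Variables a b : multi_index r -> 'I_r -> R.
Hypothesis hab : is_nn_recurrence P a b.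

Lemma typeII_diff (n : multi_index r) (i j : 'I_r) :
  P (n +e_ i) - P (n +e_ j) = (b n j - b n i) *: P n.
Proof.
have [rec _] := hab; have := rec n i; rewrite (rec n j) => /eqP.
rewrite (inj_eq (addIr _)) => /eqP E.
by apply/eqP; rewrite scalerBl subr_eq addrAC eq_sym subr_eq addrC E.
Qed.

Lemma typeII_moment_add (n : multi_index r) (i j : 'I_r) : i != j ->
  L i (P (n +e_ j) * 'X^(n i)) = - (b n j - b n i) * L i (P n * 'X^(n i)).
Proof.
move=> ij; have := congr1 (fun p => L i (p * 'X^(n i))) (typeII_diff n i j).
rewrite /= mulrBl linearB /= (@typeII_orth (n +e_ i)) ?ffunE ?eqxx ?addn1// sub0r.
by rewrite -scalerAl linearZ /= mulNr => <-; rewrite opprK.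
Qed.

Lemma typeII_moment_sub (n : multi_index r) (i : 'I_r) : (0 < n i)%N ->
  L i (P n * 'X^(n i)) = a n i * L i (P (n -e_ i) * 'X^((n -e_ i) i)).
Proof.
move=> ni_gt0; have [/(_ n i) rec _] := hab.
have := congr1 (fun p => L i (p * 'X^((n i).-1))) rec.
rewrite mulrC mulrA -exprSr prednK// mulrC !mulrDl !linearD /=.
rewrite (@typeII_orth (n +e_ i)) ?ffunE ?eqxx ?addn1 ?ltnS ?leq_pred//.
rewrite -scalerAl linearZ /= (@typeII_orth n i (n i).-1) ?prednK// mulr0 !add0r => ->.
rewrite mulr_suml linear_sum (bigD1 i)//= big1 ?addr0.
  by rewrite -scalerAl linearZ /= subn1.
(* For [k != i] the index [n -e_ k] keeps the entry [n i], so its polynomial is still orthogonal to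
   the power [(n i).-1]. *)
move=> k /andP[_ /negPf ki]; rewrite -scalerAl linearZ /= typeII_orth ?mulr0//.
by rewrite ffunE eq_sym ki subn0 prednK.
Qed.

(* [P n]`_(|n| - 1) and [P n]`_(|n| - 2), shifted so that they read 0 when |n|
   is too small. *)
Let c (n : multi_index r) := ('X * P n)`_(mi_size n).
Let e (n : multi_index r) := ('X^2 * P n)`_(mi_size n).

(** Read the recurrence at degree $|n|$: the polynomials [P (n -e_ j)] have degree $|n|-1$ and drop
    out. *)
Lemma nn_recurrence_coef1 (n : multi_index r) (k : 'I_r) : b n k = c n - c (n +e_ k).
Proof.
have [rec _] := hab; rewrite /c (rec n k) !coefD coefZ typeII_coef_size mulr1.
rewrite coef_sum big1 => [|j nj_gt0]; last first.
  by rewrite coefZ typeII_coef0 ?mulr0// -(mi_size_sub nj_gt0).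
by rewrite mi_size_add coefXM /= addr0 addrAC subrr add0r.
Qed.

(** Read the recurrence at degree $|n|-1$, where each monic [P (n -e_ j)] contributes exactly
    [a n j]. Multiplying by ['X] first moves this to degree $|n|$, which avoids a predecessor when
    [n] is zero. *)
Lemma nn_recurrence_coef2 (n : multi_index r) (k : 'I_r) :
  \sum_(j < r) a n j = e n - e (n +e_ k) - b n k * c n.
Proof.
have [rec a0] := hab; rewrite /e mi_size_add expr2 -!mulrA (rec n k).
rewrite !mulrDr !coefD -scalerAr coefZ -/(c n).
rewrite [('X * ('X * P (n +e_ k)))`_ _]coefXM /=.
(* The recurrence sums only over [0 < n j]; the convention [a n j = 0] at [n j = 0] supplies the
   other terms. *)
have -> : \sum_(j < r) a n j = \sum_(j < r | (0 < n j)%N) a n j.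
  by rewrite [RHS]big_mkcond; apply: eq_bigr => j _; case: posnP => // /a0.
rewrite mulr_sumr coef_sum [X in _ + X - _ - _](eq_bigr (a n)) => [|j nj_gt0]; last first.
  by rewrite -scalerAr coefZ -(mi_size_sub nj_gt0) coefXM /= typeII_coef_size mulr1.
by ring.
Qed.

Lemma nn_recurrence_coef2_diff (n : multi_index r) (i j : 'I_r) :
  e (n +e_ i) - e (n +e_ j) = (b n j - b n i) * c n.
Proof.
rewrite /e !mi_size_add -coefB -mulrBr typeII_diff -scalerAr coefZ.
by rewrite expr2 -mulrA coefXM.
Qed.

(** * The compatibility relations *)

(** By [nn_recurrence_coef1], [b] is minus the discrete gradient of [c], and mixed second
    differences of [c] are symmetric. *)
Lemma nn_recurrence_b (n : multi_index r) (i j : 'I_r) :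
  b (n +e_ i) j - b n j = b (n +e_ j) i - b n i.
Proof.
by rewrite !nn_recurrence_coef1 (mi_addC n i j); ring.
Qed.

Lemma nn_recurrence_suma (n : multi_index r) (i j : 'I_r) :
  \sum_(k < r) a (n +e_ j) k - \sum_(k < r) a (n +e_ i) k =
  b (n +e_ j) i * b n j - b n i * b (n +e_ i) j.
Proof.
rewrite (nn_recurrence_coef2 (n +e_ j) i) (nn_recurrence_coef2 (n +e_ i) j) (mi_addC n i j).
(* The values of [e] at [n +e_ i +e_ j] cancel; the remaining difference of [e] is expressed through
   [b] and [c], which leaves a polynomial identity in values of [c]. *)
have -> : e (n +e_ j) = e (n +e_ i) - (b n j - b n i) * c n.
  by rewrite -nn_recurrence_coef2_diff; ring.
by rewrite !nn_recurrence_coef1 (mi_addC n i j); ring.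
Qed.

(** This difference is, up to sign, the factor linking the nonzero moments of [n] and [n +e_ j]. *)
Lemma nn_recurrence_b_neq (n : multi_index r) (i j : 'I_r) : i != j -> b n j - b n i != 0.
Proof.
move=> ij; have := typeII_moment_neq0 (n +e_ j) i.
rewrite ffunE (negPf ij) addn0 typeII_moment_add// mulf_eq0 oppr_eq0 negb_or.
by case/andP.
Qed.

Lemma nn_recurrence_a_neq0 (n : multi_index r) (i : 'I_r) : (0 < n i)%N -> a n i != 0.
Proof.
move=> ni_gt0; have := typeII_moment_neq0 n i.
by rewrite typeII_moment_sub// mulf_eq0 negb_or => /andP[].
Qed.

(** With [h] and [d] as in the overview, reach [h (n +e_ j)] from [h (n -e_ i)] along two paths,
    through [n] and through [n -e_ i +e_ j]. This gives [d n * a n i = a (n +e_ j) i * d (n -e_ i)]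
    once the nonzero [h (n -e_ i)] is cancelled. *)
Lemma nn_recurrence_a_ratio (n : multi_index r) (i j : 'I_r) : i != j -> (0 < n i)%N ->
  a n i / a (n +e_ j) i = (b (n -e_ i) j - b (n -e_ i) i) / (b n j - b n i).
Proof.
move=> ij ni_gt0.
have njE : (n +e_ j) i = n i by rewrite ffunE (negPf ij) addn0.
have a_neq0 : a (n +e_ j) i != 0 by rewrite nn_recurrence_a_neq0 ?njE.
have h_neq0 := typeII_moment_neq0 (n -e_ i) i.
apply/eqP; rewrite eqr_div ?nn_recurrence_b_neq//; apply/eqP.
apply: (mulIf h_neq0).
have := @typeII_moment_sub (n +e_ j) i; rewrite njE => /(_ ni_gt0).
rewrite typeII_moment_add// mi_subDC// typeII_moment_sub//.
have -> : (n -e_ i +e_ j) i = (n -e_ i) i by rewrite ffunE (negPf ij) addn0.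
rewrite typeII_moment_add// => /(congr1 -%R) E.
by apply: etrans (etrans E _); ring.
Qed.

End TypeII.

Theorem theorem3p2 (R : realType) (r : nat) (hr : (2 <= r)%N)
  (mu : 'I_r -> real_measure R)
  (hmom : forall j : 'I_r, finite_moments (mu j))
  (hnormal : forall n : multi_index r, normal_index mu n)
  (P : multi_index r -> {poly R})
  (hP : forall n : multi_index r, is_typeII mu n (P n))
  (a b : multi_index r -> 'I_r -> R)
  (hab : is_nn_recurrence P a b)
  (i j : 'I_r) (hij : i != j) :
  (forall n : multi_index r,
     b (n +e_ i) j - b n j = b (n +e_ j) i - b n i) /\
  (forall n : multi_index r,
     \sum_(k < r) a (n +e_ j) k - \sum_(k < r) a (n +e_ i) k
     = \det (mx22 (b (n +e_ j) i) (b n i)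
                  (b (n +e_ i) j) (b n j))) /\
  (forall n : multi_index r, (1 <= n i)%N ->
     [/\ a (n +e_ j) i != 0,
         b n j - b n i != 0 &
         a n i / a (n +e_ j) i
         = (b (n -e_ i) j - b (n -e_ i) i) / (b n j - b n i)]).
Proof.
split=> [n|]; first exact: (nn_recurrence_b hP hab).
split=> [n|n ni_gt0].
  by rewrite (nn_recurrence_suma hP hab)// det_mx22E.
(* Division by zero returns 0 here, so the two nonvanishing claims certify that the quotients are
   genuine. *)
split.
- by apply: (nn_recurrence_a_neq0 hmom hP hnormal hab) => //; rewrite ffunE ltn_addr.
- exact: (nn_recurrence_b_neq hmom hP hnormal hab).
- exact: (nn_recurrence_a_ratio hmom hP hnormal hab).
Qed.
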